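(* Let $G=(V,E)$ be a finite connected simple graph with edge lengths $d\colon E\to(0,\infty)$, and let $F\colon(0,\infty)\to(0,\infty)$ be a non-increasing function. Equip $G$ with the weight distribution $w_e=\frac{F(d(e))}{d(e)}$ for each edge $e\in E$. Then the total curvature satisfies $$K(G)\geq 2|V|-2|E|,$$ with equality if and only if one of the following two conditions holds: (1) the distance function $d$ is constant on $E$ and $\mathrm{girth}(G)\geq 6$; (2) $d$ satisfies the Treelike property and $F$ is a constant function.
   Context: A weighted graph $G=(V,E,d)$ is a connected simple graph with a length function $d\colon E\to(0,\infty)$. For arbitrary vertices $x,y$, $d(x,y)$ denotes the minimum total length of a path joining $x$ and $y$; it is assumed that for every edge $xy$ this shortest-path distance equals the length of the edge $xy$. $\Gamma(x)$ is the set of neighbors of $x$, and $N(x)=\Gamma(x)\cup\{x\}$. A weight distribution is a function $w\colon E\to(0,\infty)$, written $w_{xy}=w_{yx}$; set $D_x=\sum_{y\sim x}w_{xy}$. For $\alpha\in[0,1]$ and $x\in V$ define the probability measure $\mu_x^\alpha$ by $\mu_x^\alpha(x)=\alpha$, $\mu_x^\alpha(z)=(1-\alpha)\frac{w_{xz}}{D_x}$ if $z\sim x$, and $\mu_x^\alpha(z)=0$ otherwise. A coupling between probability measures $\mu_1,\mu_2$ on $V$ is a finitely supported $A\colon V\times V\to[0,1]$ with $\sum_y A(x,y)=\mu_1(x)$ and $\sum_x A(x,y)=\mu_2(y)$; the transportation distance is $W(\mu_1,\mu_2)=\inf_A\sum_{x,y}A(x,y)d(x,y)$ over all couplings. For vertices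 $x\neq y$: $\kappa_\alpha(x,y)=1-\frac{W(\mu_x^\alpha,\mu_y^\alpha)}{d(x,y)}$, and the Ricci curvature is $\kappa(x,y)=\lim_{\alpha\to1}\frac{\kappa_\alpha(x,y)}{1-\alpha}$. The total curvature is $K(G)=\sum_{xy\in E}\kappa(x,y)$. The distance $d$ satisfies the Treelike property if for every edge $xy\in E$ and all $k\in N(x)\setminus\{y\}$, $l\in N(y)\setminus\{x\}$ one has $d(k,l)=d(k,x)+d(x,y)+d(y,l)$. The girth of $G$ is the length of a shortest cycle of the underlying (unweighted) graph, infinite if $G$ is acyclic.
   Formalization: In (2), ''F is a constant function'' is replaced by ''F is constant on the set of edge lengths d(E)'', since only these values enter K(G) and the literal ''only if'' is false; the one-vertex graph, where the measure is undefined, is excluded by |V| > 1. *)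

(* Defs.v *)
(* MathComp-Analysis; the reals are an arbitrary R : realType. *)
From HB Require Import structures.
From mathcomp Require Import all_boot all_order all_algebra.
From mathcomp Require Import all_classical all_reals all_analysis.
Import Order.TTheory GRing.Theory Num.Theory.
Import numFieldNormedType.Exports.

Set Implicit Arguments.
Unset Strict Implicit.
Unset Printing Implicit Defensive.

Local Open Scope classical_set_scope.
Local Open Scope ring_scope.

Section WeightedGraph.
Context {R : realType} {V : finType}.
Variables (adj : rel V) (len : V -> V -> R).

(* One orientation per edge {x, y}: each edge is counted exactly once. *)
Definition edges : {set V * V} :=
  [set p : V * V | adj p.1 p.2 & (enum_rank p.1 < enum_rank p.2)%N].

(* Total length of the walk x, p_0, p_1, ... *)
Fixpoint path_length (x : V) (p : seq V) : R :=
  if p is y :: q then len x y + path_length y q else 0.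

Definition joins (x y : V) (p : seq V) : Prop :=
  [/\ path adj x p, uniq (x :: p) & last x p = y].

(* There are finitely many simple paths, so in a connected graph the infimum
   is a minimum. *)
Definition dist (x y : V) : R := inf [set path_length x p | p in joins x y].

(* Values of len at non-adjacent pairs are irrelevant. *)
Record weighted_graph : Prop := WeightedGraph {
  wg_sym : symmetric adj;
  wg_irr : irreflexive adj;
  wg_conn : forall x y, connect adj x y;
  wg_len_sym : forall x y, adj x y -> len x y = len y x;
  wg_len_gt0 : forall x y, adj x y -> 0 < len x y;
  wg_geodesic : forall x y, adj x y -> dist x y = len x y }.

(* The infimum of the empty set is +oo, the value for acyclic graphs. *)
Definition girth : \bar R :=
  ereal_inf [set (size c)%:R%:E |
             c in [set c : seq V | ucycle adj c /\ (3 <= size c)%N]].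

Definition nbh (x : V) : {set V} := [set z | (z == x) || adj x z].

Definition treelike : Prop :=
  forall x y, adj x y ->
  forall k l, k \in nbh x :\ y -> l \in nbh y :\ x ->
  dist k l = dist k x + dist x y + dist y l.

(* Also applied to F o len: the weights depend on F only through its values at
   edge lengths, so constancy of F can only be characterized there. *)
Definition constant_on_edges (f : V -> V -> R) : Prop :=
  forall x y u v, adj x y -> adj u v -> f x y = f u v.

(* Finite support is automatic, V being finite. *)
Definition coupling (m1 m2 : V -> R) (A : V -> V -> R) : Prop :=
  [/\ forall x y, 0 <= A x y <= 1,
      forall x, \sum_y A x y = m1 x &
      forall y, \sum_x A x y = m2 y].

Definition transport_cost (A : V -> V -> R) : R :=
  \sum_x \sum_y A x y * dist x y.

Definition transport_dist (m1 m2 : V -> R) : R :=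
  inf [set transport_cost A | A in coupling m1 m2].

Section Curvature.
Variable w : V -> V -> R.

Definition wdeg (x : V) : R := \sum_(y | adj x y) w x y.

Definition mu (a : R) (x z : V) : R :=
  if z == x then a
  else if adj x z then (1 - a) * (w x z / wdeg x)
  else 0.

Definition kappa_alpha (a : R) (x y : V) : R :=
  1 - transport_dist (mu a x) (mu a y) / dist x y.

(* The limit is one-sided because a ranges over [0, 1]. *)
Definition ricci (x y : V) : R :=
  lim (kappa_alpha a x y / (1 - a) @[a --> 1^'-]).

Definition total_curvature : R := \sum_(p in edges) ricci p.1 p.2.

End Curvature.
End WeightedGraph.

(* Main.v *)
(* Put a = 1 - eps. The transport cost is convex in eps along mu_x^a, so the
   quotient kappa_a / (1 - a) is nondecreasing in a, and the curvature is its
   supremum. Forcing all mass through the edge xy bounds it below, already at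
   a = 1/2, by an explicit expression T(x,y). If some k, l violate the treelike
   equality at xy, then rerouting a little mass directly from k to l makes the
   inequality strict; if all of them satisfy it, a Kantorovich potential gives
   equality. Summing T over the edges and regrouping by vertices gives
     2|V| - sum_x (sum_y F(d_xy)) (sum_y 1/d_xy) / (sum_y F(d_xy)/d_xy),
   which is at least 2|V| - 2|E| by Chebyshev's sum inequality at each vertex,
   with equality iff F o d is constant around each vertex, hence on E. So
   equality in the theorem holds iff condition (2) does, and condition (1)
   implies condition (2). *)
Require Import Defs.
From HB Require Import structures.
From mathcomp Require Import all_boot all_order all_algebra.
From mathcomp Require Import all_classical all_reals all_analysis.
From mathcomp Require Import ring lra.
Import Order.TTheory GRing.Theory Num.Theory.
Import numFieldNormedType.Exports.

Local Open Scope classical_set_scope.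
Local Open Scope ring_scope.

(** * Shortest-path distance *)

Section Distance.
Context {R : realType} {V : finType} {adj : rel V} {len : V -> V -> R}.
Hypothesis hG : weighted_graph adj len.

Lemma path_length_cat x p q :
  path_length len x (p ++ q) =
  path_length len x p + path_length len (last x p) q.
Proof. by elim: p x => [|y p IH] x /=; rewrite ?add0r // IH addrA. Qed.

Lemma path_length_ge0 x p : path adj x p -> 0 <= path_length len x p.
Proof.
elim: p x => [|y p IH] x //= /andP[xy yp].
by rewrite addr_ge0 ?IH // ltW // (wg_len_gt0 hG).
Qed.

(** Loop erasure: if [x] recurs on the simple path found from [y], everything before the recurrence
    is dropped, which cannot add length. *)
Lemma shorten_walk x p : path adj x p ->
  exists2 q, joins adj x (last x p) q &
    path_length len x q <= path_length len x p.
Proof.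
elim: p x => [|y p IH] x /=; first by exists [::].
case/andP=> xy /IH[q [yq uq lq] qp].
have xy0 := ltW (wg_len_gt0 hG xy).
have [xin|xnin] := boolP (x \in y :: q); last first.
  exists (y :: q); last by rewrite /= lerD2l.
  by split=> //; [rewrite /= xy | rewrite cons_uniq xnin].
move: xin; rewrite inE; case: (eqVneq x y) xy0 => [-> xy0|_ xy0 /= xin].
  move=> _; exists q; first by split.
  by apply: (le_trans qp); rewrite lerDr.
case/splitPr: xin yq uq lq qp => q1 q2.
rewrite cat_path /= path_length_cat /= => /and3P[yq1 lx xq2] uq lq qp.
exists q2.
  split=> //; last by move: lq; rewrite last_cat.
  by move: uq; rewrite cat_uniq => /and4P[].
apply: (le_trans _ (le_trans qp _)); last by rewrite lerDr.
by rewrite addrA lerDr addr_ge0 ?path_length_ge0 // ltW // (wg_len_gt0 hG).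
Qed.

Lemma joins_exists x y : exists p, joins adj x y p.
Proof.
have /connectP[p xp ->] := wg_conn hG x y.
by have [q ? _] := shorten_walk _ _ xp; exists q.
Qed.

Lemma dist_le_joins x y p : joins adj x y p ->
  dist adj len x y <= path_length len x p.
Proof.
move=> xyp; apply: ge_inf; last by exists p.
by exists 0 => _ [q [xq _ _] <-]; exact: path_length_ge0.
Qed.

Lemma dist_le_walk x p : path adj x p ->
  dist adj len x (last x p) <= path_length len x p.
Proof.
by move=> /shorten_walk[q xq]; apply: le_trans; exact: dist_le_joins.
Qed.

(** Connectedness makes the set of path lengths nonempty, so that [inf] is not a default value. *)
Lemma dist_ge x y c :
  (forall p, joins adj x y p -> c <= path_length len x p) ->
  c <= dist adj len x y.
Proof.
move=> h; apply: lb_le_inf; last by move=> _ [p xyp <-]; exact: h.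
by have [p xyp] := joins_exists x y; exists (path_length len x p), p.
Qed.

Lemma dist_ge0 x y : 0 <= dist adj len x y.
Proof. by apply: dist_ge => p [xp _ _]; exact: path_length_ge0. Qed.

Lemma dist_xx x : dist adj len x x = 0.
Proof.
by apply/eqP; rewrite eq_le dist_ge0 andbT (@dist_le_joins x x [::]).
Qed.

Lemma dist_triangle y x z :
  dist adj len x z <= dist adj len x y + dist adj len y z.
Proof.
rewrite -lerBlDl; apply: dist_ge => q [yq _ lq].
rewrite lerBlDl -lerBlDr; apply: dist_ge => p [xp _ lp].
rewrite lerBlDr; have := @dist_le_walk x (p ++ q).
by rewrite cat_path xp last_cat path_length_cat lp lq; apply.
Qed.

Lemma path_length_rev x p : path adj x p ->
  path_length len (last x p) (rev (belast x p)) = path_length len x p.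
Proof.
elim: p x => [|y p IH] x //= /andP[xy yp].
rewrite rev_cons -cats1 path_length_cat IH //= addr0 addrC.
rewrite (_ : last _ _ = y) ?(wg_len_sym hG xy) //.
by case: p {IH} yp => //= z p _; rewrite rev_cons last_rcons.
Qed.

Lemma dist_sym x y : dist adj len x y = dist adj len y x.
Proof.
suff le_dist u v : dist adj len u v <= dist adj len v u.
  by apply/eqP; rewrite eq_le !le_dist.
apply: dist_ge => p [vp _ lp]; rewrite -path_length_rev // lp.
have lv : last u (rev (belast v p)) = v.
  by case: p vp lp => //= z p _ _; rewrite rev_cons last_rcons.
have := @dist_le_walk u (rev (belast v p)); rewrite lv; apply.
rewrite -lp rev_path; apply: sub_path vp => a b.
by rewrite (wg_sym hG).
Qed.

Lemma adj_neq {x y} : adj x y -> x != y.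
Proof. by apply: contraTneq => ->; rewrite (wg_irr hG). Qed.

Lemma dist_adj {x y} : adj x y -> dist adj len x y = len x y.
Proof. exact: wg_geodesic. Qed.

Lemma path_length_const c x p :
  (forall u v, adj u v -> len u v = c) -> path adj x p ->
  path_length len x p = c * (size p)%:R.
Proof.
move=> hc; elim: p x => [|y p IH] x /=; first by rewrite mulr0.
by case/andP=> xy yp; rewrite hc // IH // mulrS mulrDr mulr1.
Qed.

End Distance.

(** * Couplings, transport cost and duality *)

Section Transport.
Context {R : realType} {V : finType} {adj : rel V} {len : V -> V -> R}.
Hypothesis hG : weighted_graph adj len.
Implicit Types (m : V -> R) (A B : V -> V -> R).

Lemma coupling_of_marginals m1 m2 A :
  (forall x y, 0 <= A x y) -> (forall x, \sum_y A x y = m1 x) ->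
  (forall y, \sum_x A x y = m2 y) -> (forall x, m1 x <= 1) ->
  coupling m1 m2 A.
Proof.
move=> A0 A1 A2 m1le; split=> // x y; rewrite A0 /=.
apply: le_trans (m1le x); rewrite -A1 (bigD1 y) //= lerDl.
by apply: sumr_ge0.
Qed.

Lemma transport_cost_lin (a b : R) A B :
  transport_cost adj len (fun u v => a * A u v + b * B u v) =
  a * transport_cost adj len A + b * transport_cost adj len B.
Proof.
rewrite /transport_cost !mulr_sumr -big_split; apply: eq_bigr => u _ /=.
rewrite !mulr_sumr -big_split; apply: eq_bigr => v _ /=; ring.
Qed.

Lemma sum_delta (x : V) m : \sum_u (u == x)%:R * m u = m x.
Proof.
rewrite (bigD1 x) //= eqxx mul1r big1 ?addr0 // => u /negPf ->.
by rewrite mul0r.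
Qed.

Lemma sum_delta1 (x : V) : \sum_u (u == x)%:R = 1 :> R.
Proof.
by have := sum_delta x (fun=> 1); under eq_bigr do rewrite mulr1.
Qed.

Lemma transport_cost_deltal x m :
  transport_cost adj len (fun u v => (u == x)%:R * m v) =
  \sum_v m v * dist adj len x v.
Proof.
rewrite /transport_cost -(sum_delta x (fun u => \sum_v m v * dist adj len u v)).
by apply: eq_bigr => u _; rewrite mulr_sumr; apply: eq_bigr => v _; rewrite mulrA.
Qed.

Lemma transport_cost_deltar y m :
  transport_cost adj len (fun u v => (v == y)%:R * m u) =
  \sum_u m u * dist adj len u y.
Proof.
rewrite /transport_cost; apply: eq_bigr => u _.
rewrite -(sum_delta y (fun v => m u * dist adj len u v)).
by apply: eq_bigr => v _; rewrite mulrA.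
Qed.

Lemma transport_dist_le {m1 m2 A} : coupling m1 m2 A ->
  transport_dist adj len m1 m2 <= transport_cost adj len A.
Proof.
move=> cA; apply: ge_inf; last by exists A.
exists 0 => _ [B [B01 _ _] <-].
apply: sumr_ge0 => u _; apply: sumr_ge0 => v _.
by rewrite mulr_ge0 ?(dist_ge0 hG) //; case/andP: (B01 u v).
Qed.

Lemma transport_dist_ge m1 m2 c :
  (forall x, 0 <= m1 x) -> (forall x, 0 <= m2 x) ->
  \sum_x m1 x = 1 -> \sum_x m2 x = 1 ->
  (forall A, coupling m1 m2 A -> c <= transport_cost adj len A) ->
  c <= transport_dist adj len m1 m2.
Proof.
move=> m10 m20 s1 s2 h; apply: lb_le_inf; last by move=> _ [A cA <-]; exact: h.
(* The product coupling shows that the set of costs is nonempty. *)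
pose A u v := m1 u * m2 v; exists (transport_cost adj len A), A => //.
apply: coupling_of_marginals => [x y|x|y|x].
- by rewrite mulr_ge0.
- by rewrite -mulr_sumr s2 mulr1.
- by rewrite -mulr_suml s1 mul1r.
- by rewrite -s1 (bigD1 x) //= lerDl sumr_ge0.
Qed.

(* Weak Kantorovich duality. *)
Lemma transport_cost_ge m1 m2 A (f : V -> R) : coupling m1 m2 A ->
  (forall u v, 0 < m1 u -> 0 < m2 v -> f u - f v <= dist adj len u v) ->
  \sum_u m1 u * f u - \sum_v m2 v * f v <= transport_cost adj len A.
Proof.
case=> A01 A1 A2 hf.
have -> : \sum_u m1 u * f u = \sum_u \sum_v A u v * f u.
  by apply: eq_bigr => u _; rewrite -A1 mulr_suml.
have -> : \sum_v m2 v * f v = \sum_u \sum_v A u v * f v.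
  by rewrite exchange_big; apply: eq_bigr => v _; rewrite -A2 mulr_suml.
rewrite -sumrB; apply: ler_sum => u _; rewrite -sumrB; apply: ler_sum => v _.
rewrite -mulrBr; have /andP[A0 _] := A01 u v.
(* Where the coupling is positive, so are both marginals, and the Lipschitz bound on the supports
   applies. *)
move: A0; rewrite le_eqVlt => /predU1P[<-|A0]; first by rewrite !mul0r.
rewrite ler_pM2l // hf //; apply: lt_le_trans A0 _.
- rewrite -A1 (bigD1 v) //= lerDl sumr_ge0 // => z _.
  by case/andP: (A01 u z).
- rewrite -A2 (bigD1 u) //= lerDl sumr_ge0 // => z _.
  by case/andP: (A01 z v).
Qed.

End Transport.

(** Monotonicity and boundedness give convergence, without which [lim] would say nothing; used for
    the curvature ratio with [b] equal to 1. *)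
Lemma nondecreasing_left_lim {R : realType} (f : R -> R) (a b M : R) :
  a < b -> {in `[a, b[ &, {homo f : s t / s <= t}} ->
  (forall t, t \in `[a, b[ -> f t <= M) ->
  f a <= lim (f t @[t --> b^'-]) <= M.
Proof.
move=> ab fmono fM.
have fcvg : cvg (f t @[t --> b^'-]).
  apply: nondecreasing_at_left_is_cvgr; near=> c.
    have ac : a <= c by near: c; exact: nbhs_left_ge.
    move=> s t; rewrite !in_itv /= => /andP[cs sb] /andP[ct tb].
    by apply: fmono; rewrite in_itv /= ?sb ?tb ?(le_trans ac) ?ltW.
  have ac : a <= c by near: c; exact: nbhs_left_ge.
  exists M => _ [t + <-]; rewrite /= in_itv /= => /andP[ct tb].
  by apply: fM; rewrite in_itv /= tb (le_trans ac) ?ltW.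
apply/andP; split.
  apply: limr_ge => //; near=> t; apply: fmono; rewrite ?in_itv /= ?lexx ?ab //.
  - by apply/andP; split; near: t; [exact: nbhs_left_ge | exact: nbhs_left_lt].
  - by near: t; exact: nbhs_left_ge.
apply: limr_le => //; near=> t; apply: fM; rewrite in_itv /=.
by apply/andP; split; near: t; [exact: nbhs_left_ge | exact: nbhs_left_lt].
Unshelve. all: by end_near. Qed.

(** * Curvature of a single edge *)

Section RandomWalk.
Context {R : realType} {V : finType}.
Variables (adj : rel V) (len w : V -> V -> R).

(** The walk without idleness; [muE] writes [mu] as a mixture of a unit mass at [x] and this
    distribution. *)
Definition step (x y : V) : R :=
  if adj x y then w x y / wdeg adj w x else 0.

Definition mean_len (x : V) : R := \sum_y step x y * len x y.

(* The curvature the edge xy would have if all mass between N(x) \ y and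
   N(y) \ x had to pass through the edge. *)
Definition tree_curvature (x y : V) : R :=
  2 * (step x y + step y x) - (mean_len x + mean_len y) / len x y.

Hypothesis hG : weighted_graph adj len.
Hypothesis w_gt0 : forall x y, adj x y -> 0 < w x y.
Hypothesis adj_ex : forall x, exists y, adj x y.

Notation d := (dist adj len).

Lemma wdeg_gt0 x : 0 < wdeg adj w x.
Proof.
have [y xy] := adj_ex x; rewrite /wdeg (bigD1 y) //=.
rewrite ltr_wpDr ?w_gt0 // sumr_ge0 // => z /andP[xz _].
by rewrite ltW ?w_gt0.
Qed.

Lemma step_gt0 {x y} : adj x y -> 0 < step x y.
Proof. by move=> xy; rewrite /step xy divr_gt0 ?w_gt0 ?wdeg_gt0. Qed.

Lemma step_ge0 x y : 0 <= step x y.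
Proof.
by case: (boolP (adj x y)) => [/step_gt0/ltW//|/negPf xy]; rewrite /step xy.
Qed.

Lemma sum_step x : \sum_y step x y = 1.
Proof.
rewrite -big_mkcond -mulr_suml divff //.
by rewrite gt_eqF ?wdeg_gt0.
Qed.

Lemma muE a x z : mu adj w a x z = a * (z == x)%:R + (1 - a) * step x z.
Proof.
rewrite /mu /step; case: eqVneq => [->|_].
  by rewrite (wg_irr hG) mulr1 mulr0 addr0.
by rewrite mulr0 add0r; case: ifP; rewrite ?mulr0.
Qed.

Lemma sum_mu a x (f : V -> R) :
  \sum_z mu adj w a x z * f z = a * f x + (1 - a) * \sum_z step x z * f z.
Proof.
rewrite -(sum_delta x f) !mulr_sumr -big_split; apply: eq_bigr => z _ /=.
rewrite muE; ring.
Qed.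

Lemma sum_mu1 a x : \sum_z mu adj w a x z = 1.
Proof.
have := sum_mu a x (fun=> 1); under eq_bigr do rewrite mulr1.
move=> ->; under eq_bigr do rewrite mulr1.
rewrite sum_step; ring.
Qed.

Lemma mu_ge0 a x z : 0 <= a <= 1 -> 0 <= mu adj w a x z.
Proof.
case/andP=> a0 a1; rewrite muE addr_ge0 // mulr_ge0 ?step_ge0 //.
by rewrite subr_ge0.
Qed.

Lemma mu_le1 a x z : 0 <= a <= 1 -> mu adj w a x z <= 1.
Proof.
move=> a01; rewrite -(sum_mu1 a x) (bigD1 z) //= lerDl sumr_ge0 // => t _.
exact: mu_ge0.
Qed.

Lemma mu_supp {a x z} : 0 < mu adj w a x z -> z \in nbh adj x.
Proof.
rewrite /mu inE; case: eqP => // _; case: ifP => //.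
by rewrite ltxx.
Qed.

Lemma transport_dist_mu_ge a x y c : 0 <= a <= 1 ->
  (forall A, coupling (mu adj w a x) (mu adj w a y) A ->
     c <= transport_cost adj len A) ->
  c <= transport_dist adj len (mu adj w a x) (mu adj w a y).
Proof.
move=> a01 h; apply: transport_dist_ge => // *.
- exact: mu_ge0.
- exact: mu_ge0.
- exact: sum_mu1.
- exact: sum_mu1.
Qed.

(** * Monotonicity and boundedness of the curvature ratio *)

Section Edge.
Variables x y : V.
Hypothesis xy : adj x y.

Notation W a := (transport_dist adj len (mu adj w a x) (mu adj w a y)).
Notation ratio a := (kappa_alpha adj len w a x y / (1 - a)).

Lemma len_gt0 : 0 < len x y. Proof. exact: (wg_len_gt0 hG). Qed.

Lemma kappa_ratio_le a M : a < 1 ->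
  (ratio a <= M) = ((1 - M * (1 - a)) * len x y <= W a).
Proof.
move=> a1; rewrite ler_pdivrMr ?subr_gt0 // -ler_pdivlMr ?len_gt0 //.
by rewrite /kappa_alpha (dist_adj hG) // lerBlDr lerBlDl addrC -lerBlDl.
Qed.

Lemma kappa_ratio_ge a M : a < 1 ->
  (M <= ratio a) = (W a <= (1 - M * (1 - a)) * len x y).
Proof.
move=> a1; rewrite ler_pdivlMr ?subr_gt0 // -ler_pdivrMr ?len_gt0 //.
by rewrite /kappa_alpha (dist_adj hG) // lerBrDr -lerBrDl.
Qed.

(* Convexity of [W] along the segment of measures ending at [a = 1], where
   it equals [len x y]. *)
Lemma transport_dist_mu_convex a b : 0 <= a -> a <= b -> b < 1 ->
  W b <= (1 - (1 - b) / (1 - a)) * len x y + (1 - b) / (1 - a) * W a.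
Proof.
move=> a0 ab b1; set t := (1 - b) / (1 - a).
have a1 : 0 < 1 - a by rewrite subr_gt0 (le_lt_trans ab b1).
have t0 : 0 < t by apply: divr_gt0 => //; rewrite subr_gt0.
have t1 : 0 <= 1 - t by rewrite subr_ge0 ler_pdivrMr // mul1r lerD2l lerN2.
(* Hence [mu b] is [1 - t] times a unit mass plus [t] times [mu a], at [x] and at [y] alike. *)
have bE : b = (1 - t) + t * a by rewrite /t; field; rewrite gt_eqF.
have a01 : 0 <= a <= 1 by rewrite a0 ltW // (le_lt_trans ab b1).
have b01 : 0 <= b <= 1 by rewrite (le_trans a0 ab) ltW.
rewrite -lerBlDl -ler_pdivrMl //; apply: transport_dist_mu_ge => // A cA.
rewrite ler_pdivrMl // lerBlDl.
(* The coupling of the unit masses at [x] and [y], that is, of the measures at idleness 1. *)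
pose D (u v : V) : R := (u == x)%:R * (v == y)%:R.
have costD : transport_cost adj len D = len x y.
  by rewrite transport_cost_deltal sum_delta (dist_adj hG).
rewrite -costD -transport_cost_lin; apply: (transport_dist_le hG).
case: cA => A01 A1 A2; apply: coupling_of_marginals => [u v|u|v|u].
- have /andP[A0 _] := A01 u v.
  by apply: addr_ge0; apply: mulr_ge0 => //; [exact: mulr_ge0 | exact: ltW].
- rewrite big_split /= -!mulr_sumr A1 /D -?mulr_sumr.
  rewrite sum_delta1 !muE bE; ring.
- rewrite big_split /= -!mulr_sumr A2 /D -?mulr_suml.
  rewrite sum_delta1 !muE bE; ring.
- exact: mu_le1.
Qed.

Lemma kappa_ratio_nondecreasing a b : 0 <= a -> a <= b -> b < 1 ->
  ratio a <= ratio b.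
Proof.
move=> a0 ab b1; have a1 := le_lt_trans ab b1.
have a1' : 1 - a != 0 by rewrite gt_eqF ?subr_gt0.
rewrite kappa_ratio_ge //.
apply: (le_trans (transport_dist_mu_convex a b a0 ab b1)).
(* The chord bound at [b] is exactly the bound that [ratio a] prescribes there. *)
rewrite le_eqVlt; apply/orP; left; apply/eqP.
rewrite /kappa_alpha (dist_adj hG xy); field.
by rewrite a1' gt_eqF ?len_gt0.
Qed.

(** A crude bound that guarantees the limit exists. It comes from duality with the 1-Lipschitz
    function [- d x u], dropping the nonnegative mean of [d x] over the steps from [y]. *)
Lemma kappa_ratio_bounded a : 0 <= a -> a < 1 ->
  ratio a <= 1 + mean_len x / len x y.
Proof.
move=> a0 a1; rewrite kappa_ratio_le //.
have a01 : 0 <= a <= 1 by rewrite a0 ltW.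
apply: transport_dist_mu_ge => // A cA.
apply: (le_trans _ (transport_cost_ge _ _ A (fun u => - d x u) cA _)); last first.
  by move=> u v _ _; have := dist_triangle hG u x v; lra.
rewrite !sum_mu (dist_xx hG) (dist_adj hG) //.
have -> : \sum_z step x z * - d x z = - mean_len x.
  rewrite -sumrN; apply: eq_bigr => z _; rewrite /step.
  by case: ifP => [xz|]; rewrite ?mul0r ?oppr0 // mulrN (dist_adj hG).
have sy : \sum_z step y z * - d x z <= 0.
  rewrite sumr_le0 // => z _.
  by rewrite mulr_ge0_le0 ?step_ge0 // oppr_le0 (dist_ge0 hG).
have : 0 <= (1 - a) * - (\sum_z step y z * - d x z).
  by rewrite mulr_ge0 // ?oppr_ge0 // subr_ge0 ltW.
have -> : (1 - (1 + mean_len x / len x y) * (1 - a)) * len x y =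
   a * len x y - (1 - a) * mean_len x by field; rewrite gt_eqF ?len_gt0.
lra.
Qed.

(** The ratios increase to the curvature, so a cheap coupling at one idleness suffices; an upper
    bound on the curvature asks for all of them. *)
Lemma ricci_ge c a : 0 <= a -> a < 1 ->
  W a <= (1 - c * (1 - a)) * len x y -> c <= ricci adj len w x y.
Proof.
move=> a0 a1; rewrite -kappa_ratio_ge // => /le_trans; apply.
suff /andP[] : ratio a <= ricci adj len w x y <= 1 + mean_len x / len x y by [].
apply: nondecreasing_left_lim => // [s t|t]; rewrite !in_itv /=.
- move=> /andP[sa _] /andP[_ t1] st.
  by apply: kappa_ratio_nondecreasing => //; apply: le_trans sa.
- move=> /andP[ta t1].
  by apply: kappa_ratio_bounded => //; apply: le_trans ta.
Qed.

Lemma ricci_le c :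
  (forall a, 0 <= a -> a < 1 -> (1 - c * (1 - a)) * len x y <= W a) ->
  ricci adj len w x y <= c.
Proof.
move=> h; suff /andP[] : ratio 0 <= ricci adj len w x y <= c by [].
apply: nondecreasing_left_lim => // [s t|t]; rewrite !in_itv /=.
- by move=> /andP[s0 _] /andP[_ t1] st; exact: kappa_ratio_nondecreasing.
- by move=> /andP[t0 t1]; rewrite kappa_ratio_le // h.
Qed.

End Edge.
(** For a neighbor [k] of [x] other than [y], the excess of the route through [x] over the distance
    from [k] to [y]. The correction makes it 0 at [k = y]. *)
Definition slack (x y k : V) : R :=
  len x k + len x y - 2 * len x y * (k == y)%:R - d k y.

Definition mean_slack (x y : V) : R := \sum_k step x k * slack x y k.

Lemma step_slack_ge0 {x y} k : adj x y -> 0 <= step x k * slack x y k.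
Proof.
move=> xy; rewrite /step; case: ifPn => [xk|_]; last by rewrite mul0r.
have := step_ge0 x k; rewrite /step xk => s0; apply: mulr_ge0 => //.
rewrite /slack; case: eqVneq => [->|_]; first by rewrite (dist_xx hG) mulr1; lra.
have := dist_triangle hG x k y.
rewrite (dist_sym hG k x) (dist_adj hG xk) (dist_adj hG xy) mulr0; lra.
Qed.

Lemma mean_slack_ge0 {x y} : adj x y -> 0 <= mean_slack x y.
Proof. by move=> xy; apply: sumr_ge0 => k _; exact: step_slack_ge0. Qed.

Lemma mean_slack_ge {x y} k : adj x y -> step x k * slack x y k <= mean_slack x y.
Proof.
move=> xy; rewrite /mean_slack (bigD1 k) //= lerDl sumr_ge0 // => z _.
exact: step_slack_ge0.
Qed.

Lemma sum_step_mul x (c : R) : \sum_k step x k * c = c.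
Proof. by rewrite -mulr_suml sum_step mul1r. Qed.

(** The steps from [x] that land on [y] need no return through [x], which saves the edge twice. *)
Lemma sum_step_dist x y :
  \sum_k step x k * d k y =
  mean_len x + len x y - 2 * len x y * step x y - mean_slack x y.
Proof.
rewrite -[X in _ + X - _ - _](sum_step_mul x).
rewrite -(sum_delta y (step x)) mulr_sumr -big_split -!sumrB.
apply: eq_bigr => k _; rewrite /slack /=; ring.
Qed.

(** Diverting mass [t] from the route [k] to [y] forfeits [t] times the slack of [k]. Up to half of
    [step x k], this is paid for by the [mean_slack x y / 2] already saved in the cost of
    [bridge]. *)
Lemma step_dist_mean_slack {x y} k : adj x y -> k \in nbh adj x :\ y ->
  exists2 s, 0 < s & ((k == x) || (s <= step x k / 2)) /\
    forall t, 0 <= t <= s ->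
      t * (d k x + len x y - d k y) <= mean_slack x y / 2.
Proof.
move=> xy; rewrite !inE => /andP[ky]; case: eqVneq => [-> _|kx /= xk].
  (* For [k = x] the loss is zero, so any positive cap would do. *)
  exists 1 => //; split=> [|t _]; first by [].
  rewrite (dist_xx hG) (dist_adj hG) //.
  by rewrite add0r subrr mulr0 divr_ge0 ?mean_slack_ge0.
exists (step x k / 2); first by rewrite divr_gt0 ?step_gt0.
split=> [|t /andP[t0 ts]]; first by rewrite lexx.
have := mean_slack_ge k xy.
have s0 : 0 <= slack x y k by rewrite -(pmulr_rge0 _ (step_gt0 xk)) step_slack_ge0.
have -> : d k x + len x y - d k y = slack x y k.
  by rewrite /slack (negPf ky) mulr0 subr0 (dist_sym hG k x) (dist_adj hG xk).
have := ler_wpM2r s0 ts; lra.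
Qed.

(* At [a = 1/2], [mu x] is the average of a unit mass at [x] and of the step
   distribution; send the steps from [x] to [y], and [x] to the steps from
   [y]. *)
Definition bridge (x y u v : V) : R :=
  2^-1 * ((v == y)%:R * step x u) + 2^-1 * ((u == x)%:R * step y v).

Lemma transport_cost_bridge x y : adj x y ->
  transport_cost adj len (bridge x y) =
  (1 - tree_curvature x y / 2) * len x y
    - mean_slack x y / 2 - mean_slack y x / 2.
Proof.
move=> xy; rewrite /bridge transport_cost_lin.
rewrite transport_cost_deltal transport_cost_deltar.
under [X in _ + _ * X]eq_bigr do rewrite (dist_sym hG).
rewrite !sum_step_dist -(wg_len_sym hG xy) /tree_curvature.
by field; rewrite gt_eqF ?(wg_len_gt0 hG).
Qed.

(* Added with weight [t], this sends mass [t] directly from [k] to [l] instead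
   of along [k -> y] and [x -> l]; it vanishes for [k = x] or [l = y]. *)
Definition reroute (x y k l u v : V) : R :=
  1 * ((u == k)%:R * ((v == l)%:R - (v == y)%:R))
    + (-1) * ((u == x)%:R * ((v == l)%:R - (v == y)%:R)).

Lemma sum_delta_sub (l y : V) (f : V -> R) :
  \sum_v ((v == l)%:R - (v == y)%:R) * f v = f l - f y.
Proof. by under eq_bigr do rewrite mulrBl; rewrite sumrB !sum_delta. Qed.

Lemma transport_cost_reroute x y k l :
  transport_cost adj len (reroute x y k l) =
  d k l - d k y - (d x l - d x y).
Proof.
rewrite /reroute transport_cost_lin !transport_cost_deltal !sum_delta_sub; ring.
Qed.

(** The marginals of [reroute] vanish. Unless it is zero, its negative entries sit at [(k, y)] and
    [(x, l)], where [bridge] has mass [step x k / 2] and [step y l / 2]; hence the two caps on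
    [t]. *)
Lemma coupling_reroute x y k l t : 0 <= t ->
  (k == x) || (t <= step x k / 2) -> (l == y) || (t <= step y l / 2) ->
  coupling (mu adj w 2^-1 x) (mu adj w 2^-1 y)
    (fun u v => 1 * bridge x y u v + t * reroute x y k l u v).
Proof.
move=> t0 tk tl.
have half01 : 0 <= (2^-1 : R) <= 1 by apply/andP; split; lra.
apply: coupling_of_marginals => [u v|u|v|u].
- rewrite /bridge /reroute.
  have := step_ge0 x u; have := step_ge0 y v.
  have [->|kx] := eqVneq k x.
    by case: (v == y); case: (v == l); case: (u == x); rewrite /=; lra.
  have [->|ly] := eqVneq l y.
    by case: (v == y); case: (u == x); case: (u == k); rewrite /=; lra.
  move: tk tl; rewrite (negPf kx) (negPf ly) /=.
  have [->|_] := eqVneq u k; have [->|_] := eqVneq v l;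
    rewrite ?(negPf kx) ?(negPf ly) /=;
    try case: (v == y); try case: (u == x); rewrite /=; lra.
- rewrite big_split /= -!mulr_sumr !big_split /= -!mulr_sumr -!mulr_suml.
  rewrite sumrB !sum_delta1 sum_step muE; lra.
- rewrite big_split /= -!mulr_sumr !big_split /= -!mulr_sumr -!mulr_suml.
  rewrite !sum_delta1 sum_step muE; lra.
- exact: mu_le1.
Qed.

Lemma ricci_ge_tree_curvature x y : adj x y ->
  tree_curvature x y <= ricci adj len w x y.
Proof.
move=> xy; apply: (ricci_ge x y xy (tree_curvature x y) 2^-1); [lra|lra|].
(* Weight 0 leaves [bridge] alone. *)
have := transport_dist_le hG (coupling_reroute x y x y 0 (lexx 0) _ _).
rewrite !eqxx => /(_ isT isT).
rewrite transport_cost_lin transport_cost_bridge // mul1r mul0r addr0.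
have := mean_slack_ge0 xy; have := mean_slack_ge0 (x := y) (y := x).
rewrite (wg_sym hG) => /(_ xy) s1 s2.
set W := transport_dist _ _ _ _; lra.
Qed.

Lemma ricci_gt_tree_curvature x y k l : adj x y ->
  k \in nbh adj x :\ y -> l \in nbh adj y :\ x ->
  d k l != d k x + d x y + d y l ->
  tree_curvature x y < ricci adj len w x y.
Proof.
move=> xy kx ly kl; have yx : adj y x by rewrite (wg_sym hG).
have {}kl : d k l < d k x + d x y + d y l.
  rewrite lt_neqAle kl /= (le_trans (dist_triangle hG x k l)) //.
  by rewrite -addrA lerD2l (dist_triangle hG).
have [s s0 [sk sP]] := step_dist_mean_slack k xy kx.
have [r r0 [rl rP]] := step_dist_mean_slack l yx ly.
pose t := Num.min s r.
have t0 : 0 < t by rewrite lt_min s0.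
have ts : t <= s by rewrite ge_min lexx.
have tr : t <= r by rewrite ge_min lexx orbT.
have {}sP := sP t; rewrite ltW //= in sP; have {}sP := sP ts.
have {}rP := rP t; rewrite ltW //= in rP; have {}rP := rP tr.
have tk : (k == x) || (t <= step x k / 2).
  by case/orP: sk => [->//|/(le_trans ts) ->]; rewrite orbT.
have tl : (l == y) || (t <= step y l / 2).
  by case/orP: rl => [->//|/(le_trans tr) ->]; rewrite orbT.
have := transport_dist_le hG (coupling_reroute x y k l t (ltW t0) tk tl).
rewrite transport_cost_lin transport_cost_bridge // transport_cost_reroute.
set W := transport_dist _ _ _ _ => Wle.
(* The net gain of rerouting once the two mean slacks have absorbed the losses at [k] and [l]. *)
pose e := t * (d k x + d x y + d y l - d k l).
have e0 : 0 < e by rewrite mulr_gt0 // subr_gt0.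
have l0 := wg_len_gt0 hG xy.
(* At idleness 1/2 the ratio divides by [1 - a = 1/2], hence the factor 2. *)
apply: (@lt_le_trans _ _ (tree_curvature x y + 2 * e / len x y)).
  by rewrite ltrDl divr_gt0 // mulr_gt0.
apply: (ricci_ge x y xy (tree_curvature x y + 2 * e / len x y) 2^-1).
- lra.
- lra.
have -> : (1 - (tree_curvature x y + 2 * e / len x y) * (1 - 2^-1)) * len x y
  = (1 - tree_curvature x y / 2) * len x y - e by field; rewrite gt_eqF.
apply: (le_trans Wle); rewrite /e.
move: sP rP; rewrite (dist_sym hG l y) (dist_sym hG l x) -(wg_len_sym hG xy).
rewrite (dist_adj hG xy); lra.
Qed.

(** The potential [f] measures signed distance to [y] through the edge. The treelike equality makes
    it drop by exactly [d k l] from [k] on the side of [x] to [l] on the side of [y]. *)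
Lemma ricci_le_tree_curvature x y : adj x y ->
  (forall k l, k \in nbh adj x :\ y -> l \in nbh adj y :\ x ->
     d k l = d k x + d x y + d y l) ->
  ricci adj len w x y <= tree_curvature x y.
Proof.
move=> xy tree; have yx : adj y x by rewrite (wg_sym hG).
have l0 := wg_len_gt0 hG xy.
have xNy : x != y := adj_neq hG xy.
have xx : x \in nbh adj x :\ y by rewrite !inE eqxx xNy.
have yy : y \in nbh adj y :\ x by rewrite !inE eqxx eq_sym xNy.
(* A vertex on both sides would be at distance at least [d x y > 0] from itself. *)
have disj k : k \in nbh adj x :\ y -> k \in nbh adj y :\ x -> False.
  move=> kx ky; have := tree k k kx ky.
  have := dist_ge0 hG k x; have := dist_ge0 hG y k.
  rewrite (dist_xx hG) (dist_adj hG xy); lra.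
pose f u := if u \in nbh adj x :\ y then d u x + d x y
            else if u \in nbh adj y :\ x then - d y u else 0.
have fx u : u \in nbh adj x :\ y -> f u = d u x + d x y by rewrite /f => ->.
have fy u : u \in nbh adj y :\ x -> f u = - d y u.
  by rewrite /f; case: ifP => [/disj h /h//|_ ->].
have fLip u v : u \in nbh adj x -> v \in nbh adj y -> f u - f v <= d u v.
  move=> ux vy; have [uy|uNy] := eqVneq u y; have [vx|vNx] := eqVneq v x.
  - rewrite uy vx (fx x xx) (fy y yy) !(dist_xx hG).
    have := dist_ge0 hG y x; have := dist_ge0 hG x y; lra.
  - have v' : v \in nbh adj y :\ x by rewrite in_setD1 vNx.
    by rewrite uy (fy y yy) (fy v v') (dist_xx hG); lra.
  - have u' : u \in nbh adj x :\ y by rewrite in_setD1 uNy.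
    by rewrite vx (fx x xx) (fx u u') (dist_xx hG); lra.
  - have u' : u \in nbh adj x :\ y by rewrite in_setD1 uNy.
    have v' : v \in nbh adj y :\ x by rewrite in_setD1 vNx.
    rewrite (fx u u') (fy v v') (tree u v u' v') opprK; exact: lexx.
apply: ricci_le => // a a0 a1.
have a01 : 0 <= a <= 1 by rewrite a0 ltW.
apply: transport_dist_mu_ge => // A cA.
apply: (le_trans _ (transport_cost_ge _ _ A f cA _)); last first.
  by move=> u v /mu_supp ux /mu_supp vy; exact: fLip.
rewrite !sum_mu (fx x xx) (fy y yy) !(dist_xx hG) (dist_adj hG xy).
(* The term [z = y] stands apart: [f y] is 0, not twice the edge length, whence the correction. *)
have -> : \sum_z step x z * f z =
    mean_len x + len x y - 2 * len x y * step x y.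
  rewrite -[X in _ + X - _](sum_step_mul x).
  rewrite -(sum_delta y (step x)) mulr_sumr -big_split -sumrB.
  apply: eq_bigr => z _ /=; have [->|zy] := eqVneq z y.
    by rewrite (fy y yy) (dist_xx hG) ?eqxx /=; ring.
  rewrite /step; case: ifP => [xz|_]; last by rewrite !(mul0r, mulr0); lra.
  rewrite fx; last by rewrite !inE zy xz orbT.
  by rewrite (dist_sym hG z x) !(dist_adj hG) // ?(negPf zy) /=; ring.
have -> : \sum_z step y z * f z =
    2 * len x y * step y x - mean_len y.
  rewrite -(sum_delta x (step y)) mulr_sumr -sumrB.
  apply: eq_bigr => z _ /=; have [->|zx] := eqVneq z x.
    rewrite (fx x xx) (dist_xx hG) (dist_adj hG xy) -(wg_len_sym hG xy).
    by rewrite ?eqxx /=; ring.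
  rewrite /step; case: ifP => [yz|_]; last by rewrite !(mul0r, mulr0); lra.
  rewrite fy; last by rewrite !inE zx yz orbT.
  by rewrite !(dist_adj hG) // ?(negPf zx) /=; ring.
rewrite /tree_curvature le_eqVlt; apply/orP; left; apply/eqP.
by field; rewrite gt_eqF.
Qed.

End RandomWalk.

(** * Sums over edges and Chebyshev's identity *)

Lemma sum_edges {R : realType} {V : finType} {adj : rel V} {len : V -> V -> R}
    (hG : weighted_graph adj len) (h : V -> V -> R) :
  \sum_(p in edges adj) (h p.1 p.2 + h p.2 p.1) =
  \sum_x \sum_(y | adj x y) h x y.
Proof.
rewrite pair_big_dep /= big_split /=.
rewrite [RHS](bigID (fun p => (enum_rank p.1 < enum_rank p.2)%N)) /=.
congr (_ + _); first by apply: eq_bigl => p; rewrite inE.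
(* Swapping turns the pairs of the opposite orientation into members of [edges]; equal ranks would
   be a loop. *)
rewrite [RHS](reindex_inj (h := fun p : V * V => (p.2, p.1))) /=; last first.
  by move=> [a b] [a' b'] [-> ->].
apply: eq_bigl => -[x y]; rewrite inE /= (wg_sym hG y x).
case xy: (adj x y) => //=; rewrite -leqNgt [RHS]leq_eqVlt.
case: eqP => // /ord_inj/enum_rank_inj xEy.
by move: xy; rewrite xEy (wg_irr hG).
Qed.

Lemma card_edges {R : realType} {V : finType} {adj : rel V} {len : V -> V -> R}
    (hG : weighted_graph adj len) :
  2 * #|edges adj|%:R = \sum_x \sum_(y | adj x y) 1 :> R.
Proof. by rewrite -(sum_edges hG (fun _ _ => 1)) sumr_const mulr_natr. Qed.

(** For oppositely or similarly ordered [a] and [b] all terms on the left have one sign, which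
    yields Chebyshev's inequality and its equality case. *)
Lemma chebyshev_sum {R : comRingType} {I : finType} (P : pred I) (a b : I -> R) :
  \sum_(i | P i) \sum_(j | P j) (a i - a j) * (b i - b j) =
  2 * ((\sum_(i | P i) 1) * (\sum_(i | P i) a i * b i)
       - (\sum_(i | P i) a i) * (\sum_(i | P i) b i)).
Proof.
set n := \sum_(i | P i) 1; set S := \sum_(i | P i) a i * b i.
set A := \sum_(i | P i) a i; set B := \sum_(i | P i) b i.
have sumE i : \sum_(j | P j) (a i - a j) * (b i - b j) =
    n * (a i * b i) - a i * B - b i * A + S.
  rewrite mulr_suml !mulr_sumr -!sumrB -big_split; apply: eq_bigr => j _ /=; ring.
under eq_bigr do rewrite sumE.
rewrite big_split /= !sumrB -mulr_sumr -!mulr_suml -/n -/S -/A -/B.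
have -> : \sum_(i | P i) S = n * S.
  by rewrite mulr_suml; under [RHS]eq_bigr do rewrite mul1r.
ring.
Qed.

(** * From constant length and large girth to the treelike property *)

Lemma girth_ge {R : realType} {V : finType} {adj : rel V} {n : nat} {c : seq V} :
  (n%:R%:E <= girth (R := R) adj)%E -> ucycle adj c -> (3 <= size c)%N ->
  (n <= size c)%N.
Proof.
move=> ng cc c3; rewrite -(ler_nat R) -lee_fin; apply: (le_trans ng).
by apply: ereal_inf_lbound; exists c.
Qed.

(** With constant lengths, distances count edges. A path from [k] to [l] with fewer edges than the
    route through [xy] would produce a cycle of length 3, 4 or 5. *)
Lemma girth_treelike {R : realType} {V : finType} {adj : rel V}
    {len : V -> V -> R} (hG : weighted_graph adj len) :
  constant_on_edges adj len -> (6%:R%:E <= girth (R := R) adj)%E ->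
  treelike adj len.
Proof.
move=> lc g6 x y xy k l kx ly.
have yx : adj y x by rewrite (wg_sym hG).
have xNy := adj_neq hG xy.
have no_cycle c : cycle adj c -> uniq c -> (3 <= size c < 6)%N -> False.
  move=> cc uc /andP[c3]; rewrite ltnNge.
  by rewrite (girth_ge g6 _ c3) //; apply/andP.
have lenE u v : adj u v -> len u v = len x y by move=> uv; exact: lc.
apply/eqP; rewrite eq_le; apply/andP; split.
  apply: (le_trans (dist_triangle hG x k l)).
  by rewrite -addrA lerD2l (dist_triangle hG).
apply: (dist_ge hG) => p [kp up lp].
rewrite (path_length_const (len x y) k p lenE kp) (dist_adj hG xy).
have len0 := ltW (wg_len_gt0 hG xy).
move: kx ly; rewrite !inE => /andP[kNy kx] /andP[lNx ly].
have size_ge n : (n <= size p)%N -> len x y * n%:R <= len x y * (size p)%:R.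
  by move=> np; rewrite ler_wpM2l // ler_nat.
(* The paths must have at least 1, 2, 2 and 3 edges in the four cases. *)
have [kEx|kNx] := eqVneq k x; have [lEy|lNy] := eqVneq l y.
- rewrite kEx lEy !(dist_xx hG) add0r addr0 -[X in X <= _]mulr1.
  apply: (size_ge 1%N).
  by case: p lp {kp up size_ge} => //= kl; move: xNy; rewrite -kEx -lEy kl eqxx.
- have yl : adj y l by move: ly; rewrite (negPf lNy).
  rewrite kEx (dist_xx hG) (dist_adj hG yl) (lenE _ _ yl).
  rewrite (_ : _ + _ = len x y * 2%:R); last by ring.
  apply: size_ge; case: p lp kp {up} => [|a [|b p]] //=; rewrite kEx.
    by move=> xl; rewrite xl eqxx in lNx.
  move=> -> /andP[xl _]; exfalso; apply: (no_cycle [:: x; y; l]) => //=.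
    by rewrite xy yl (wg_sym hG) xl.
  by rewrite !inE negb_or xNy eq_sym lNx eq_sym lNy.
- have xk : adj x k by move: kx; rewrite (negPf kNx).
  have kx' : adj k x by rewrite (wg_sym hG).
  rewrite lEy (dist_xx hG) (dist_adj hG kx') (lenE _ _ kx').
  rewrite (_ : _ + _ = len x y * 2%:R); last by ring.
  apply: size_ge; case: p lp kp {up} => [|a [|b p]] //=; rewrite lEy.
    by move=> ky; rewrite ky eqxx in kNy.
  move=> -> /andP[ky _]; exfalso; apply: (no_cycle [:: k; x; y]) => //=.
    by rewrite kx' xy (wg_sym hG) ky.
  by rewrite !inE negb_or kNx kNy xNy.
have yl : adj y l by move: ly; rewrite (negPf lNy).
have xk : adj x k by move: kx; rewrite (negPf kNx).
have kx' : adj k x by rewrite (wg_sym hG).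
rewrite (dist_adj hG yl) (lenE _ _ yl) (dist_adj hG kx') (lenE _ _ kx').
rewrite (_ : _ + _ = len x y * 3%:R); last by ring.
(* Triangles go first: then the middle vertex of a two-edge path from [k] to [l] is neither [x] nor
   [y], and the pentagon below is simple. *)
have no_xl : ~~ adj x l.
  apply/negP => xl; apply: (no_cycle [:: x; y; l]) => //=.
    by rewrite xy yl (wg_sym hG) xl.
  by rewrite !inE negb_or xNy eq_sym lNx eq_sym lNy.
have no_ky : ~~ adj k y.
  apply/negP => ky; apply: (no_cycle [:: k; x; y]) => //=.
    by rewrite kx' xy (wg_sym hG) ky.
  by rewrite !inE negb_or kNx kNy xNy.
apply: size_ge; case: p lp kp up => [|a [|b [|c p]]] //=.
- by move=> kl; rewrite kl (wg_sym hG) yl in no_ky.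
- move=> -> /andP[kl _] _; exfalso; apply: (no_cycle [:: k; x; y; l]) => //=.
    by rewrite kx' xy yl (wg_sym hG) kl.
  by rewrite !inE !negb_or kNx kNy (adj_neq hG kl) xNy eq_sym lNx eq_sym lNy.
- move=> -> /and3P[ka al _] /and3P[]; rewrite !inE => /norP[kNa kNl] aNl _.
  have aNx : x != a by apply: contraNneq no_xl => ->.
  have aNy : y != a by apply: contraNneq no_ky => ->.
  exfalso; apply: (no_cycle [:: k; x; y; l; a]) => //=.
    by rewrite kx' xy yl (wg_sym hG l) al (wg_sym hG) ka.
  rewrite !inE !negb_or kNx kNy kNl kNa xNy aNx aNy.
  by rewrite eq_sym lNx eq_sym lNy eq_sym aNl.
Qed.

(** * Summation over the graph and the equality case *)

Section TotalCurvature.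
Context {R : realType} {V : finType}.
Variables (adj : rel V) (len : V -> V -> R) (F : R -> R).
Hypothesis hG : weighted_graph adj len.
Hypothesis adj_ex : forall x, exists y, adj x y.
Hypothesis F_gt0 : forall t : R, 0 < t -> 0 < F t.
Hypothesis F_noninc : forall s t : R, 0 < s -> s <= t -> F t <= F s.

Let w x y := F (len x y) / len x y.

Lemma weight_gt0 x y : adj x y -> 0 < w x y.
Proof. by move=> /(wg_len_gt0 hG) l0; rewrite divr_gt0 ?F_gt0. Qed.

(** For these weights [mean_len] is the sum of [F(d)] over that of [F(d)/d], so this is Chebyshev's
    gap at [x] for [F(d)] and [1/d], divided by [wdeg]. *)
Definition vertex_defect (x : V) : R :=
  \sum_(y | adj x y) 1
  - mean_len adj len w x * \sum_(y | adj x y) (len x y)^-1.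

Lemma vertex_defectE x :
  2 * wdeg adj w x * vertex_defect x =
  \sum_(y | adj x y) \sum_(z | adj x z)
    (F (len x y) - F (len x z)) * ((len x y)^-1 - (len x z)^-1).
Proof.
have D0 : wdeg adj w x != 0 by rewrite gt_eqF ?wdeg_gt0 //; exact: weight_gt0.
rewrite chebyshev_sum /vertex_defect -/(wdeg adj w x).
have -> : mean_len adj len w x = (\sum_(y | adj x y) F (len x y)) / wdeg adj w x.
  rewrite /mean_len mulr_suml [RHS]big_mkcond; apply: eq_bigr => y _.
  rewrite /step /w; case: ifP => [/(wg_len_gt0 hG) l0|_]; last by rewrite !mul0r.
  by field; rewrite D0 gt_eqF.
by field.
Qed.

(** Both [F] and the inverse are non-increasing in the length. *)
Lemma F_inv_len_ge0 x y z : adj x y -> adj x z ->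
  0 <= (F (len x y) - F (len x z)) * ((len x y)^-1 - (len x z)^-1).
Proof.
move=> /(wg_len_gt0 hG) y0 /(wg_len_gt0 hG) z0.
have [yz|/ltW zy] := leP (len x y) (len x z).
  by rewrite mulr_ge0 // subr_ge0 ?F_noninc // lef_pV2.
by rewrite mulr_le0 // subr_le0 ?F_noninc // lef_pV2.
Qed.

Lemma vertex_defect_ge0 x : 0 <= vertex_defect x.
Proof.
have D0 : 0 < wdeg adj w x by apply: wdeg_gt0 => //; exact: weight_gt0.
have D2 : 0 < 2 * wdeg adj w x by rewrite mulr_gt0.
rewrite -(pmulr_rge0 _ D2) vertex_defectE.
by apply: sumr_ge0 => y xy; apply: sumr_ge0 => z xz; exact: F_inv_len_ge0.
Qed.

(** Every product in the double sum vanishes; even when it is the inverse lengths that agree, so do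
    the values of [F]. *)
Lemma vertex_defect_eq0 x y z : vertex_defect x = 0 ->
  adj x y -> adj x z -> F (len x y) = F (len x z).
Proof.
move=> x0 xy xz.
have := vertex_defectE x; rewrite x0 mulr0 => /esym/eqP.
rewrite psumr_eq0 => [|u xu]; last first.
  by apply: sumr_ge0 => v xv; exact: F_inv_len_ge0.
move=> /allP/(_ y (mem_index_enum y)); rewrite xy /=.
rewrite psumr_eq0 => [|v xv]; last exact: F_inv_len_ge0.
move=> /allP/(_ z (mem_index_enum z)); rewrite xz /= mulf_eq0 !subr_eq0.
by case/orP=> [/eqP//|/eqP/invr_inj ->].
Qed.

Lemma vertex_defect_const x :
  constant_on_edges adj (fun u v => F (len u v)) -> vertex_defect x = 0.
Proof.
move=> Fc; have D0 : 0 < wdeg adj w x by apply: wdeg_gt0 => //; exact: weight_gt0.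
have /eqP := vertex_defectE x; rewrite big1 => [|y xy].
  rewrite !mulf_eq0 pnatr_eq0 /= gt_eqF //=; exact: eqP.
by rewrite big1 // => z xz; rewrite (Fc x y x z) // subrr mul0r.
Qed.

(** The two trailing sums are the losses in Chebyshev's inequality and in the comparison with
    [tree_curvature]. Both are nonnegative, so the bound and its equality case can be read off. *)
Lemma total_curvatureE :
  total_curvature adj len w =
  2 * #|V|%:R - 2 * #|edges adj|%:R + \sum_x vertex_defect x
  + \sum_(p in edges adj)
      (ricci adj len w p.1 p.2 - tree_curvature adj len w p.1 p.2).
Proof.
suff treeE : \sum_(p in edges adj) tree_curvature adj len w p.1 p.2 =
    2 * #|V|%:R - 2 * #|edges adj|%:R + \sum_x vertex_defect x.
  by rewrite [X in _ + X]sumrB treeE addrC subrK.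
(* The share of [tree_curvature] charged to the endpoint [x]. Each vertex then collects 2 minus its
   degree plus its defect. *)
pose h x y := 2 * step adj w x y - mean_len adj len w x / len x y.
transitivity (\sum_x \sum_(y | adj x y) h x y).
  rewrite -(sum_edges hG); apply: eq_bigr => -[x y]; rewrite inE => /andP[/= xy _].
  by rewrite /h /tree_curvature -(wg_len_sym hG xy); ring.
rewrite (card_edges hG) -sumr_const mulr_sumr -sumrB -big_split.
apply: eq_bigr => x _; rewrite /h sumrB -!mulr_sumr /vertex_defect /=.
have -> : \sum_(y | adj x y) step adj w x y = 1.
  rewrite -(sum_step adj w weight_gt0 adj_ex x) [RHS](bigID (adj x)) /=.
  rewrite [X in _ = _ + X]big1 ?addr0 // => y /negPf xy.
  by rewrite /step xy.
ring.
Qed.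

Lemma total_curvature_ge :
  2 * #|V|%:R - 2 * #|edges adj|%:R <= total_curvature adj len w.
Proof.
rewrite total_curvatureE -addrA lerDl addr_ge0 //.
  by apply: sumr_ge0 => x _; exact: vertex_defect_ge0.
apply: sumr_ge0 => -[x y]; rewrite inE => /andP[/= xy _].
by rewrite subr_ge0 ricci_ge_tree_curvature //; exact: weight_gt0.
Qed.

(** Consecutive edges of a walk share a vertex, so local constancy spreads by connectedness. *)
Lemma const_on_edges_F :
  (forall x y z, adj x y -> adj x z -> F (len x y) = F (len x z)) ->
  constant_on_edges adj (fun x y => F (len x y)).
Proof.
move=> Fx x y u v xy uv; have /connectP[p xp lp] := wg_conn hG x u.
elim: p x y xy xp lp => [|z p IH] x y xy /=.
  by move=> _ ux; rewrite -ux in xy *; exact: Fx.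
case/andP=> xz zp lp; have zx : adj z x by rewrite (wg_sym hG).
by rewrite (Fx x y z) // (wg_len_sym hG xz); exact: IH.
Qed.

Lemma total_curvature_eq :
  total_curvature adj len w = 2 * #|V|%:R - 2 * #|edges adj|%:R <->
  treelike adj len /\ constant_on_edges adj (fun x y => F (len x y)).
Proof.
have tree_le x y : adj x y ->
    tree_curvature adj len w x y <= ricci adj len w x y.
  by apply: ricci_ge_tree_curvature => //; exact: weight_gt0.
have gap_ge0 (p : V * V) : p \in edges adj ->
    0 <= ricci adj len w p.1 p.2 - tree_curvature adj len w p.1 p.2.
  by rewrite inE => /andP[xy _]; rewrite subr_ge0 tree_le.
have S1 : 0 <= \sum_x vertex_defect x.
  by apply: sumr_ge0 => x _; exact: vertex_defect_ge0.
have S2 : 0 <= \sum_(p in edges adj)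
    (ricci adj len w p.1 p.2 - tree_curvature adj len w p.1 p.2).
  exact: sumr_ge0.
rewrite total_curvatureE -addrA; split=> [E|[tree Fc]]; last first.
  rewrite big1 => [|x _]; last exact: vertex_defect_const.
  rewrite add0r big1 ?addr0 // => -[x y]; rewrite inE => /andP[/= xy _].
  apply/eqP; rewrite subr_eq0 eq_le tree_le // andbT.
  apply: ricci_le_tree_curvature => //; [exact: weight_gt0|exact: tree].
have /eqP : \sum_x vertex_defect x + \sum_(p in edges adj)
    (ricci adj len w p.1 p.2 - tree_curvature adj len w p.1 p.2) = 0.
  by apply: (addrI (2 * #|V|%:R - 2 * #|edges adj|%:R)); rewrite E addr0.
rewrite paddr_eq0 // => /andP[E1 E2].
split; last first.
  apply: const_on_edges_F => x y z; apply: vertex_defect_eq0.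
  move: E1; rewrite psumr_eq0 => [|v _]; last exact: vertex_defect_ge0.
  by move=> /allP/(_ x (mem_index_enum x))/eqP.
have tree x y k l : (x, y) \in edges adj ->
    k \in nbh adj x :\ y -> l \in nbh adj y :\ x ->
    dist adj len k l = dist adj len k x + dist adj len x y + dist adj len y l.
  move=> xye kx ly; apply/eqP/negPn/negP => kl.
  have xy : adj x y by move: xye; rewrite inE => /andP[].
  have := ricci_gt_tree_curvature adj len w hG weight_gt0 adj_ex
    x y k l xy kx ly kl.
  move: E2; rewrite psumr_eq0 => [|p pe]; last exact: gap_ge0.
  move=> /allP/(_ (x, y) (mem_index_enum _)); rewrite xye /= subr_eq0 => /eqP ->.
  by rewrite ltxx.
move=> x y xy k l kx ly.
(* Only one orientation lies in [edges]; the other follows by symmetry of the distance. *)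
have [xye|xye] := boolP ((x, y) \in edges adj); first exact: tree.
have yxe : (y, x) \in edges adj.
  move: xye; rewrite !inE /= xy (wg_sym hG y x) xy /= -leqNgt leq_eqVlt.
  case/orP=> // /eqP/ord_inj/enum_rank_inj yx.
  by move: xy; rewrite yx (wg_irr hG).
rewrite (dist_sym hG k l) (tree y x l k yxe ly kx).
rewrite (dist_sym hG l y) (dist_sym hG y x) (dist_sym hG x k); ring.
Qed.

End TotalCurvature.

Theorem theorem3p3 (R : realType) (V : finType) (adj : rel V)
    (len : V -> V -> R) (F : R -> R)
    (hG : weighted_graph adj len)
    (hV : (1 < #|V|)%N)
    (hF0 : forall t : R, 0 < t -> 0 < F t)
    (hF : forall s t : R, 0 < s -> s <= t -> F t <= F s) :
  let w := fun x y : V => F (len x y) / len x y in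
  let K := total_curvature adj len w in
  let bound := 2 * #|V|%:R - 2 * #|edges adj|%:R in
  bound <= K /\
  (K = bound <->
     (constant_on_edges adj len /\ (6%:R%:E <= girth (R := R) adj)%E) \/
     (treelike adj len /\
      constant_on_edges adj (fun x y : V => F (len x y)))).
Proof.
move=> w K bound.
(* This keeps every [wdeg] positive. A one-vertex graph would violate the bound, with total
   curvature 0 against 2. *)
have adj_ex x : exists y, adj x y.
  have [y yx] : exists y, y != x.
    by move/card_gt1P: hV => [a [b [_ _ ab]]];
      case: (eqVneq a x) => [<-|]; [exists b; rewrite eq_sym | exists a].
  have /connectP[[|z p] /=] := wg_conn hG x y.
    by move=> _ /eqP; rewrite (negPf yx).
  by case/andP=> xz _ _; exists z.
split; first exact: total_curvature_ge.
have eqK := total_curvature_eq adj len F hG adj_ex hF0 hF.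
split=> [/eqK|[[lc g6]|]]; [by right| |by move/eqK].
(* Condition (1) is a special case of (2). *)
apply/eqK; split; first exact: (girth_treelike hG).
by move=> x y u v xy uv; rewrite (lc x y u v).
Qed.
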